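(* Let $p$ be an odd prime, $n\ge 1$, and let $f(x)=\sum_{i=1}^k a_i x^{p^{\alpha_i}+1}\in\mathbb F_{p^n}[x]$ with $k\ge 1$, integers $0\le\alpha_1<\cdots<\alpha_k$, and $a_k\ne 0$. Let $\beta$ be a nonsquare of $\mathbb F_{p^n}$ and put $$\tilde f(x)=\sum_{i=1}^k a_i\beta^{\frac12(p^{\alpha_i}+1)}x^{p^{\alpha_i}+1}\in\mathbb F_{p^n}[x].$$ Let $s>0$ be an integer. Then $l_n(f)+l_n(\tilde f)+l_{2^sn}(f)$ is even. Moreover, $$t_{2^sn}(f)=\begin{cases} t_n(f)\,t_n(\tilde f)&\text{if } l_n(f)\equiv l_n(\tilde f)\pmod 2,\\ t_n(f)\,t_n(\tilde f)\,(-1)^{\frac18(p^2-1)s}&\text{if } l_n(f)\not\equiv l_n(\tilde f)\pmod 2.\end{cases}$$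
   Context: Every quadratic form $F$ on an $N$-dimensional $\mathbb F_p$-vector space ($p$ odd) is, after a linear change of coordinates, equal to $x_1^2+\cdots+x_{r-1}^2+d x_r^2$ with $r\ge 0$ and $d\in\mathbb F_p^*$. The integer $r$ is the rank of $F$, $N-r$ is its nullity, and $\eta(d)\in\{\pm1\}$ is its type, where $\eta$ is the quadratic character of $\mathbb F_p$; if $F=0$ its type is defined to be $1$. For a positive integer $N$ divisible by $n$ and a polynomial $g\in\mathbb F_{p^n}[x]$ that is a linear combination of monomials $x^{p^{j}+1}$, $j\ge0$, let $\mathrm{Tr}_N$ be the absolute trace $\mathbb F_{p^N}\to\mathbb F_p$; the map $x\mapsto \mathrm{Tr}_N(g(x))$ is a quadratic form on the $N$-dimensional $\mathbb F_p$-space $\mathbb F_{p^N}$, and $l_N(g)$, $t_N(g)$ denote its nullity and type. *)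

(* Defs.v *)
From mathcomp Require Import all_boot all_order all_fingroup all_algebra all_field.

Set Implicit Arguments.
Unset Strict Implicit.
Unset Printing Implicit Defensive.

Import GRing.Theory.

Local Open Scope ring_scope.

Definition quadratic_char (p : nat) (d : 'F_p) : int :=
  if d == 0 then 0 else if [exists y : 'F_p, y ^+ 2 == d] then 1 else -1.

(* x_1^2 + ... + x_(r-1)^2 + d x_r^2, with x_i stored in column i - 1. *)
Definition diag_form (p N r : nat) (d : 'F_p) (x : 'rV['F_p]_N) : 'F_p :=
  \sum_(i < N | (i.+1 < r)%N) x 0 i ^+ 2 + \sum_(i < N | i.+1 == r) d * x 0 i ^+ 2.

Section QuadraticForm.

Variables (p : nat) (V : vectType 'F_p) (F : V -> 'F_p).

Let N := \dim {:V}.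

Definition in_coords (x : 'rV['F_p]_N) : 'F_p :=
  F (\sum_(i < N) x 0 i *: (vbasis {:V})`_i).

Definition has_diag_form (r : nat) (d : 'F_p) : bool :=
  (d != 0) &&
  [exists M : 'M['F_p]_N, (M \in unitmx) &&
     [forall x : 'rV['F_p]_N, in_coords (x *m M) == diag_form r d x]].

(* Meaningful when F is a quadratic form and p is an odd prime: a pair (r, d)
   then exists, r is unique, and so is the square class of d when r > 0. *)
Definition diagonalization : option ('I_N.+1 * 'F_p) :=
  [pick rd : 'I_N.+1 * 'F_p | has_diag_form rd.1 rd.2].

Definition qf_rank : nat :=
  if diagonalization is Some (r, _) then r else 0.

Definition qf_nullity : nat := (N - qf_rank)%N.

Definition qf_type : int :=
  if diagonalization is Some (r, d) then
    if r == 0 :> nat then 1 else quadratic_char d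
  else 1.

End QuadraticForm.

(* galTrace takes its values in the copy 'F_p%:A of the prime field in L; the
   scalar c below is unique. *)
Definition abs_trace (p : nat) (L : splittingFieldType 'F_p) (x : L) : 'F_p :=
  odflt 0 [pick c : 'F_p | c%:A == galTrace 1 {:L} x].

(* For the extension L of K given by iota, with N the degree of L over 'F_p,
   trace_form iota g is the form Tr_N(g(x)), so trace_nullity iota g and
   trace_type iota g are l_N(g) and t_N(g). *)
Section TraceForm.

Variables (p : nat) (K L : splittingFieldType 'F_p).
Variables (iota : {rmorphism K -> L}) (g : {poly K}).

Definition trace_form (x : L) : 'F_p := abs_trace (map_poly iota g).[x].

Definition trace_nullity : nat := qf_nullity trace_form.

Definition trace_type : int := qf_type trace_form.

End TraceForm.

(* Main.v *)
From HB Require Import structures.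
Require Import Defs.
From mathcomp Require Import all_boot all_order all_fingroup all_algebra all_field.
From mathcomp Require Import cyclic zify ring.

Set Implicit Arguments.
Unset Strict Implicit.
Unset Printing Implicit Defensive.

Import GRing.Theory.

Local Open Scope ring_scope.

(* Let q = p^n and let sigma be the q-Frobenius of the extension L of K of
   degree 2^s. It is an isometry of Q = Tr_L(f(x)), so L is the orthogonal sum
   of ker(sigma - 1) = K, of ker(sigma + 1) = gamma K with gamma^2 = beta, and
   of ker(sigma^(2^m) + 1) for 0 < m < s. On the first two summands Q is 2^s
   times the form of f, respectively of f~, over K. On each other summand
   J = sigma^(2^(m-1)) is an isometry with J^2 = -1, so x and J x are
   orthogonal, Q(J x) = Q(x), and splitting off such pairs gives an orthogonal
   basis with an even number of nonzero values, whose product is a square.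
   Hence rank_L = rank + rank~ mod 2 and t_L = t t~ eta(2)^(s (rank + rank~)),
   where eta(2) = (-1)^((p^2-1)/8). *)

(** * Quadratic characters *)

Lemma expf_half_card (F : finFieldType) (x : F) :
  odd #|F| -> x != 0 ->
  (x ^+ (#|F|.-1 %/ 2) == 1) || (x ^+ (#|F|.-1 %/ 2) == -1).
Proof.
move=> oddF x0; rewrite -sqrf_eq1 -exprM.
have -> : (#|F|.-1 %/ 2 * 2 = #|F|.-1)%N by have := finNzRing_gt1 F; lia.
have F0 : (0 < #|F|)%N by have := finNzRing_gt1 F; lia.
by apply/eqP/(mulfI x0); rewrite -exprS prednK // expf_card mulr1.
Qed.

(** With q elements, the unit group is cyclic with a generator g. For x = g^k, x^((q-1)/2) = 1 says
    that q - 1 divides k(q-1)/2; then k is even and g^(k/2) is a root. *)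
Lemma euler_criterion (F : finFieldType) (x : F) :
  odd #|F| -> x != 0 ->
  [exists y, y ^+ 2 == x] = (x ^+ (#|F|.-1 %/ 2) == 1).
Proof.
move=> oddF x0; have F1 : (1 < #|F|)%N := finNzRing_gt1 F.
have half : (2 * (#|F|.-1 %/ 2) = #|F|.-1)%N by lia.
have card_unit (y : F) : y != 0 -> y ^+ #|F|.-1 = 1.
  move=> y0; apply: (mulfI y0); rewrite -exprS prednK ?expf_card ?mulr1 //; lia.
apply/existsP/eqP => [[y /eqP yx]|x1].
  rewrite -yx -exprM half card_unit //.
  by apply: contra_neq x0 => y0; rewrite -yx y0 expr0n.
have ux : x \is a GRing.unit by rewrite unitfE.
pose u : {unit F} := Sub x ux.
have /cyclicP[g defG] := field_unit_group_cyclic [group of [set: {unit F}]].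
have : u \in <[g]>%g by rewrite -defG inE.
case/cycleP => k uk.
have og : #[g]%g = #|F|.-1 by rewrite orderE -defG card_finField_unit.
have : (u ^+ (#|F|.-1 %/ 2) = 1)%g.
  by apply: val_inj; rewrite /= FinRing.val_unitX.
rewrite uk -expgM => /eqP; rewrite -order_dvdn og.
have m0 : (0 < #|F|.-1 %/ 2)%N by lia.
move: half m0; set m := (_ %/ 2)%N => <- m0; rewrite dvdn_pmul2r //.
case/dvdnP => j kj; exists (val (g ^+ j)%g).
by rewrite -FinRing.val_unitX -expgM -kj -uk.
Qed.

Section PrimeField.

Variable p : nat.
Hypotheses (p_pr : prime p) (p_odd : odd p).

Lemma quadratic_char_expr (d : 'F_p) :
  d != 0 -> quadratic_char d = if d ^+ (p.-1 %/ 2) == 1 then 1 else -1.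
Proof.
move=> d0; rewrite /quadratic_char (negPf d0) euler_criterion ?card_Fp //.
Qed.

Lemma two_neq0 : (2 : 'F_p) != 0.
Proof.
rewrite -(dvdn_pcharf (pchar_Fp p_pr)); apply/negP=> /(dvdn_leq (ltn0Sn 1)).
by have := prime_gt1 p_pr; lia.
Qed.

Lemma quadratic_charM (c d : 'F_p) :
  c != 0 -> d != 0 -> quadratic_char (c * d) = quadratic_char c * quadratic_char d.
Proof.
move=> c0 d0; rewrite !quadratic_char_expr ?mulf_neq0 // exprMn.
have := @expf_half_card 'F_p d; have := @expf_half_card 'F_p c.
rewrite card_Fp // => /(_ p_odd c0) hc /(_ p_odd d0) hd.
have m1 : (-1 : 'F_p) == 1 = false.
  by apply: contraNF two_neq0 => /eqP h; rewrite -[2]/(1 + 1 : 'F_p) -[X in X + _]h addNr.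
by case/orP: hc => /eqP->; case/orP: hd => /eqP->; rewrite ?mulrNN ?mul1r ?mulr1 ?m1 ?eqxx.
Qed.

Lemma quadratic_char1 : quadratic_char (1 : 'F_p) = 1.
Proof. by rewrite quadratic_char_expr ?oner_neq0 // expr1n eqxx. Qed.

Lemma quadratic_char_sqr (e : 'F_p) : e != 0 -> quadratic_char (e ^+ 2) = 1.
Proof.
move=> e0; rewrite /quadratic_char expf_eq0 (negPf e0).
by case: ifP => // /existsP[]; exists e.
Qed.

Lemma quadratic_charX (d : 'F_p) k :
  d != 0 -> quadratic_char (d ^+ k) = quadratic_char d ^+ k.
Proof.
move=> d0; elim: k => [|k IHk]; first by rewrite !expr0 quadratic_char1.
by rewrite !exprS quadratic_charM ?expf_neq0 // IHk.
Qed.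

(* Compare the two expansions of (1 + i)^p, using (1 + i)^2 = 2i. *)
Lemma quadratic_char2 (R : fieldType) (i : R) :
  p \in [pchar R] -> i ^+ 2 = -1 ->
  quadratic_char (2 : 'F_p) = (-1) ^+ ((p ^ 2 - 1) %/ 8).
Proof.
move=> chRp i2; set m := (p.-1 %/ 2)%N.
have pE : p = (2 * m).+1 by rewrite /m; have := prime_gt0 p_pr; lia.
have R2 : (2 : R) != 0.
  rewrite -(dvdn_pcharf chRp); apply/negP=> /(dvdn_leq (ltn0Sn 1)).
  by have := prime_gt1 p_pr; lia.
have i1 : 1 + i != 0.
  apply: contraNneq R2 => i1.
  by rewrite (_ : 2 = (1 + i) * (1 - i) + (i ^+ 2 + 1)); [rewrite i1 i2; apply/eqP|]; ring.
have key : (2 : R) ^+ m = (-1) ^+ ((p ^ 2 - 1) %/ 8).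
  have : (1 + i) ^+ (2 * m).+1 = 1 + i ^+ (2 * m).+1.
    rewrite -pE; have := pFrobenius_autD_comm chRp (mulrC 1 i).
    by rewrite !pFrobenius_autE expr1n.
  rewrite !exprS !exprM i2.
  rewrite (_ : (1 + i) ^+ 2 = 2 * i); last by rewrite sqrrD i2; ring.
  rewrite exprMn.
  have half8 k : (p ^ 2 - 1 = k * 8)%N -> ((p ^ 2 - 1) %/ 8 = k)%N.
    by move->; rewrite mulnK.
  have i0 : i != 0 by apply: contra_eq_neq i2 => ->; rewrite expr0n /= eq_sym oppr_eq0 oner_neq0.
  have sgn j : (-1 : R) ^+ j * (-1) ^+ j = 1 by rewrite -exprMn mulrNN mul1r expr1n.
  have sgn_neq0 j : (-1 : R) ^+ j != 0 by rewrite signr_eq0.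
  (* Since p = 2m + 1, (p^2-1)/8 = m(m+1)/2, which has the parity of j for m = 2j and of j + 1 for m
     = 2j + 1. *)
  have /orP[/eqP mj|/eqP mj] : (m == (m./2).*2) || (m == (m./2).*2.+1) by lia.
    move: (m./2) mj => j mj.
    rewrite (half8 (2 * (j * j) + j)%N); last by rewrite pE mj; lia.
    rewrite exprD exprM sqrrN !expr1n mul1r {2 3}mj -mul2n !exprM i2 sqrrN !expr1n mulr1.
    rewrite -[RHS]mulr1 => /(mulfI i1) h.
    by apply: (mulIf (sgn_neq0 j)); rewrite sgn.
  move: (m./2) mj => j mj.
  rewrite (half8 (2 * (j * (j + 1)) + j.+1)%N); last by rewrite pE mj; lia.
  rewrite exprD exprM sqrrN !expr1n mul1r {2 3}mj !exprS -mul2n !exprM i2 sqrrN !expr1n.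
  (* As i^2 = -1, 1 - i = -i(1 + i), so the factor 1 + i cancels here too. *)
  rewrite mulr1 (_ : 1 + i * -1 = (1 + i) * - i + (i ^+ 2 + 1)); last by ring.
  rewrite i2 addNr addr0 => /(mulfI i1) h.
  apply: (mulIf (sgn_neq0 j)); apply: (mulfI i0).
  by rewrite mulN1r mulNr sgn mulrN1 -h; ring.
have n1 : (-1 : R) == 1 = false.
  by apply: contraNF R2 => /eqP h; rewrite -[2]/(1 + 1 : R) -[X in X + _]h addNr.
rewrite quadratic_char_expr ?two_neq0 // -/m.
(* In any field of characteristic p, 2^m = 1 says that p divides 2^m - 1; this carries the value
   from [R] back to the prime field. *)
have two_exp (S : fieldType) : p \in [pchar S] -> ((2 : S) ^+ m == 1) = (p %| 2 ^ m - 1)%N.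
  by move=> chS; rewrite (dvdn_pcharf chS) natrB ?expn_gt0 // natrX subr_eq0.
rewrite two_exp ?pchar_Fp // -(two_exp R) // key -(signr_odd R) -(signr_odd int).
by case: odd; rewrite ?expr1 ?expr0 ?n1 ?eqxx.
Qed.

End PrimeField.

(** * Congruent diagonal matrices *)

(* A = X G X^T with G = R A R^T, since the rows of R A span those of A. *)
Lemma det_gram_sqr (F : fieldType) (N r r' : nat) (A : 'M[F]_N)
    (R : 'M[F]_(r, N)) (R' : 'M[F]_(r', N)) :
  A^T = A -> \rank A = r -> r = r' -> \det (R *m A *m R^T) != 0 ->
  exists e, \det (R' *m A *m R'^T) = e ^+ 2 * \det (R *m A *m R^T).
Proof.
move=> symA rA rr'; subst r'; set G := R *m A *m R^T => detG.
have rkG : \rank G = r by rewrite mxrank_unit // unitmxE unitfE.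
have /submxP[X AX] : (A <= R *m A)%MS.
  have /mxrank_leqif_sup : (R *m A <= A)%MS by apply: submxMl.
  case=> le_r <-; rewrite eqn_leq le_r rA.
  by apply: leq_trans (mxrankM_maxl _ R^T); rewrite rkG leqnn.
have AE : A = X *m G *m X^T.
  by rewrite {1}AX -{1}symA AX !trmx_mul symA /G !mulmxA.
exists (\det (R' *m X)).
rewrite AE [in LHS](_ : _ *m R'^T = R' *m X *m G *m (R' *m X)^T).
  by rewrite !det_mulmx det_tr; ring.
by rewrite trmx_mul !mulmxA.
Qed.

(** A selection matrix: multiplying [diag_mx c] by it on the left and by its transpose on the right
    keeps exactly the nonzero diagonal entries. *)
Definition support_mx (F : fieldType) (N : nat) (c : 'rV[F]_N) :
    'M[F]_(#|[set i | c 0 i != 0]|, N) :=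
  \matrix_(k, j) (enum_val k == j)%:R.

Section DiagonalSupport.

Variables (F : fieldType) (N : nat) (c : 'rV[F]_N).

Let I := [set i | c 0 i != 0].
Let R := support_mx c.

Let R_mul (m : nat) (B : 'M[F]_(N, m)) k j : (R *m B) k j = B (enum_val k) j.
Proof.
rewrite mxE (bigD1 (enum_val k)) //= mxE eqxx mul1r big1 ?addr0 // => i ik.
by rewrite mxE eq_sym (negPf ik) mul0r.
Qed.

Let mul_Rt (m : nat) (B : 'M[F]_(m, N)) k j : (B *m R^T) j k = B j (enum_val k).
Proof. by rewrite -[B *m R^T]trmxK trmx_mul trmxK mxE R_mul mxE. Qed.

Lemma det_diag_support : \det (R *m diag_mx c *m R^T) = \prod_(i in I) c 0 i.
Proof.
rewrite (_ : _ *m R^T = diag_mx (\row_k c 0 (enum_val k))).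
  by rewrite det_diag [RHS]big_enum_val; apply: eq_bigr => k _; rewrite mxE.
by apply/matrixP=> k j; rewrite mul_Rt R_mul !mxE (inj_eq enum_val_inj).
Qed.

(** The invertible minor cut out by [R] bounds the rank below; the factorization of [diag_mx c]
    through [R^T] bounds it above. *)
Lemma rank_diag_support : \rank (diag_mx c) = #|I|.
Proof.
apply/eqP; rewrite eqn_leq; apply/andP; split; last first.
  rewrite -[leqLHS](@mxrank_unit _ _ (R *m diag_mx c *m R^T)).
    by apply: leq_trans (mxrankM_maxl _ _) (mxrankM_maxr _ _).
  rewrite unitmxE unitfE det_diag_support prodf_seq_neq0.
  by apply/allP=> i _; apply/implyP; rewrite inE.
rewrite (_ : diag_mx c = R^T *m (R *m diag_mx c)).
  exact: leq_trans (mxrankM_maxl _ _) (rank_leq_col _).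
apply/matrixP=> i j; rewrite [RHS]mxE.
have [ci|ci] := boolP (i \in I).
  rewrite (bigD1 (enum_rank_in ci i)) //= R_mul enum_rankK_in // !mxE.
  rewrite enum_rankK_in // eqxx mul1r big1 ?addr0 // => k ki.
  rewrite !mxE (negPf (_ : enum_val k != i)) ?mul0r //.
  by apply: contraNneq ki => ik; rewrite -[X in enum_rank_in _ X]ik enum_valK_in.
rewrite big1 => [|k _].
  by move: ci; rewrite inE negbK mxE => /eqP->; rewrite mul0rn.
rewrite !mxE (negPf (_ : enum_val k != i)) ?mul0r //.
by apply: contraNneq ci => <-; apply: enum_valP.
Qed.

End DiagonalSupport.

(** Both products are Gram determinants of the single matrix [diag_mx c], for the rows of
    [support_mx c] and of [support_mx c' *m P], so they differ by a square. This makes rank and type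
    independent of the diagonalization. *)
Lemma congruent_diag (F : fieldType) (N : nat) (P : 'M[F]_N) (c c' : 'rV[F]_N) :
  P \in unitmx -> P *m diag_mx c *m P^T = diag_mx c' ->
  #|[set i | c' 0 i != 0]| = #|[set i | c 0 i != 0]| /\
  exists2 e, e != 0 &
    \prod_(i in [set i | c' 0 i != 0]) c' 0 i =
    e ^+ 2 * \prod_(i in [set i | c 0 i != 0]) c 0 i.
Proof.
move=> uP PE.
have rk : \rank (diag_mx c') = \rank (diag_mx c).
  rewrite -PE mxrankMfree ?row_free_unit ?unitmx_tr //.
  by rewrite eqmxMfull ?row_full_unit.
have cardE := rk; rewrite !rank_diag_support in cardE.
split=> //.
have prod_neq0 (b : 'rV[F]_N) : \prod_(i in [set i | b 0 i != 0]) b 0 i != 0.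
  by rewrite prodf_seq_neq0; apply/allP=> i _; apply/implyP; rewrite inE.
have := @det_gram_sqr F N _ _ (diag_mx c)
  (support_mx c) (support_mx c' *m P).
rewrite det_diag_support.
case/(_ (tr_diag_mx _) (rank_diag_support _) (esym cardE) (prod_neq0 c)) => e.
rewrite trmx_mul !mulmxA -(mulmxA _ P) -(mulmxA _ _ P^T) PE det_diag_support => ce.
exists e => //; apply: contraNneq (prod_neq0 c') => e0.
by rewrite ce e0 expr0n mul0r.
Qed.

(** * Orthogonal bases *)

Section OrthogonalBases.

Variables (F : fieldType) (V : vectType F) (Q : V -> F).

Definition polar (x y : V) : F := Q (x + y) - Q x - Q y.

(** As [polar] is symmetric, linearity in the first argument gives bilinearity. *)
Definition quadratic_form : Prop :=
  (forall a x, Q (a *: x) = a ^+ 2 * Q x) /\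
  (forall a x y z, polar (a *: x + y) z = a * polar x z + polar y z).

(** Distinctness is of vectors, not of positions; a basis has no repetitions, so the two agree
    there. *)
Definition orthogonal_seq (b : seq V) : Prop :=
  {in b &, forall x y, x != y -> polar x y = 0}.

Hypotheses (F2 : (2 : F) != 0) (quadQ : quadratic_form).

Lemma polarC x y : polar x y = polar y x.
Proof. by rewrite /polar (addrC x) addrAC. Qed.

Lemma quadratic_formZ a x : Q (a *: x) = a ^+ 2 * Q x.
Proof. by case: quadQ. Qed.

Lemma polarxx x : polar x x = 2 * Q x.
Proof.
rewrite /polar -[x + x]/(x *+ 2) -scaler_nat quadratic_formZ; ring.
Qed.

Lemma polarPl a x y z : polar (a *: x + y) z = a * polar x z + polar y z.
Proof. by case: quadQ. Qed.

Lemma polar0l y : polar 0 y = 0.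
Proof. by have := polarPl (-1) y y y; rewrite scaleN1r addNr mulN1r addNr. Qed.

Lemma polarDl x y z : polar (x + y) z = polar x z + polar y z.
Proof. by rewrite -[x]scale1r polarPl scale1r mul1r. Qed.

Lemma polarZl a x y : polar (a *: x) y = a * polar x y.
Proof. by rewrite -[a *: x]addr0 polarPl polar0l addr0. Qed.

Lemma polarNl x y : polar (- x) y = - polar x y.
Proof. by rewrite -scaleN1r polarZl mulN1r. Qed.

Lemma polarDr x y z : polar z (x + y) = polar z x + polar z y.
Proof. by rewrite !(polarC z) polarDl. Qed.

Lemma polarZr a x y : polar y (a *: x) = a * polar y x.
Proof. by rewrite !(polarC y) polarZl. Qed.

Lemma polarNr x y : polar y (- x) = - polar y x.
Proof. by rewrite !(polarC y) polarNl. Qed.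

Lemma polar_suml (I : finType) (f : I -> V) y :
  polar (\sum_i f i) y = \sum_i polar (f i) y.
Proof. exact: (big_morph (polar^~ y) (fun u v => polarDl u v y) (polar0l y)). Qed.

Lemma polar_sumr (I : finType) (f : I -> V) y :
  polar y (\sum_i f i) = \sum_i polar y (f i).
Proof. by rewrite polarC polar_suml; apply: eq_bigr => i _; apply: polarC. Qed.

Lemma exists_perp x : exists W : {vspace V}, forall y, (y \in W) = (polar x y == 0).
Proof.
have lin : linear (polar x : V -> F^o).
  by move=> a u v; rewrite polarDr polarZr.
pose g : {linear V -> F^o} := HB.pack (polar x : V -> F^o)
  (GRing.isLinear.Build F V F^o _ (polar x : V -> F^o) lin).
by exists (lker (linfun g)) => y; rewrite memv_ker lfunE.
Qed.


Lemma orth_basis_cat (U W : {vspace V}) (b b' : seq V) :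
  (U :&: W = 0)%VS -> {in U & W, forall x y, polar x y = 0} ->
  basis_of U b -> basis_of W b' -> orthogonal_seq b -> orthogonal_seq b' ->
  basis_of (U + W) (b ++ b') /\ orthogonal_seq (b ++ b').
Proof.
move=> UW0 oUW bU bW ob ob'; split.
  by apply: cat_basis => //; apply/directv_addP.
move=> x y; rewrite !mem_cat => /orP[xb|xb] /orP[yb|yb] xy.
- exact: ob.
- by apply: oUW; [apply: (basis_mem bU) | apply: (basis_mem bW)].
- by rewrite polarC; apply: oUW; [apply: (basis_mem bU) | apply: (basis_mem bW)].
- exact: ob'.
Qed.

(** One Gram-Schmidt step: y minus its projection (polar x y / polar x x) x lies in the complement
    of x, where polar x x = 2 Q x is nonzero. *)
Lemma orth_basis_cons (U W : {vspace V}) (x : V) (b : seq V) :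
  x \in U -> Q x != 0 -> (forall y, (y \in W) = (polar x y == 0)) ->
  basis_of (U :&: W) b -> orthogonal_seq b ->
  basis_of U (x :: b) /\ orthogonal_seq (x :: b).
Proof.
move=> xU Qx WE bUW ob.
have Bx : polar x x != 0 by rewrite polarxx mulf_neq0.
have x0 : x != 0 by apply: contraNneq Bx => ->; rewrite polar0l.
have ->: U = (<[x]> + (U :&: W))%VS.
  apply/eqP; rewrite eqEsubv subv_add -memvE xU capvSl !andbT.
  apply/subvP=> y yU; rewrite -[y](addrNK ((polar x y / polar x x) *: x)) addrC.
  apply: memv_add; first by rewrite memvZ ?memv_line.
  rewrite memv_cap rpredB ?memvZ //= WE polarDr polarNr polarZr.
  by rewrite divfK // subrr.
rewrite -cat1s; apply: orth_basis_cat => //.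
- apply/eqP; rewrite -subv0; apply/subvP=> y.
  rewrite !memv_cap WE => /andP[/vlineP[a ->] /andP[_]].
  by rewrite polarZr mulf_eq0 (negPf Bx) orbF => /eqP->; rewrite scale0r mem0v.
- move=> _ y /vlineP[a ->]; rewrite memv_cap WE => /andP[_ /eqP xy].
  by rewrite polarZl xy mulr0.
- exact: seq1_basis.
- by move=> u v; rewrite !inE => /eqP-> /eqP->; rewrite eqxx.
Qed.

(** A finite test on basis vectors and their pairwise sums suffices: if Q vanishes on all of these,
    so does [polar] on pairs of basis vectors. *)
Lemma isotropic_or_not (U : {vspace V}) :
  (exists2 x, x \in U & Q x != 0) \/
  (forall x, x \in vbasis U -> Q x = 0) /\ orthogonal_seq (vbasis U).
Proof.
pose s := vbasis U ++ [seq x + y | x <- vbasis U, y <- vbasis U].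
have sU x : x \in s -> x \in U.
  rewrite mem_cat => /orP[/vbasis_mem//|/allpairsP[[u v] /= [/vbasis_mem uU /vbasis_mem vU ->]]].
  exact: rpredD.
have [/hasP[x /sU xU Qx]|/hasPn Q0] := boolP (has (fun x => Q x != 0) s).
  by left; exists x.
have {}Q0 x : x \in s -> Q x = 0 by move/Q0; rewrite negbK => /eqP.
have Qb x : x \in vbasis U -> Q x = 0 by move=> xb; apply: Q0; rewrite mem_cat xb.
right; split=> // x y xb yb _; rewrite /polar (Qb x) // (Qb y) // !subr0.
by apply: Q0; rewrite mem_cat allpairs_f ?orbT.
Qed.

Lemma dim_cap_perp (U W : {vspace V}) x :
  x \in U -> Q x != 0 -> (forall y, (y \in W) = (polar x y == 0)) ->
  (\dim (U :&: W) < \dim U)%N.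
Proof.
move=> xU Qx WE; rewrite ltn_neqAle dimvS ?capvSl // andbT.
rewrite (dimv_leqif_eq (capvSl U W)); apply: contraNneq Qx => UW.
move: xU; rewrite -UW memv_cap WE polarxx mulf_eq0 (negPf F2).
by case/andP.
Qed.

Lemma exists_orth_basis (U : {vspace V}) :
  exists b, basis_of U b /\ orthogonal_seq b.
Proof.
have [n] := ubnP (\dim U); elim: n U => // n IHn U dimU.
have [[x xU Qx]|[_ oU]] := isotropic_or_not U; last first.
  by exists (vbasis U); split=> //; apply: vbasisP.
have [W WE] := exists_perp x.
have [|b [bU ob]] := IHn (U :&: W)%VS.
  by apply: leq_trans (dim_cap_perp xU Qx WE) _; rewrite -ltnS.
by exists (x :: b); apply: orth_basis_cons ob.
Qed.

(** The vectors x and J x are orthogonal with equal values, and J preserves the complement of both,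
    so induction on the dimension makes the nonzero values come in equal pairs. *)
Lemma exists_orth_basis_isometry (U : {vspace V}) (J : V -> V) :
  {morph J : x y / x + y} -> (forall x, Q (J x) = Q x) ->
  (forall x, x \in U -> J x \in U) -> (forall x, x \in U -> J (J x) = - x) ->
  exists b, [/\ basis_of U b, orthogonal_seq b,
    ~~ odd (count (fun x => Q x != 0) b) &
    exists2 e, e != 0 & \prod_(x <- b | Q x != 0) Q x = e ^+ 2].
Proof.
move=> JD QJ.
have BJ x y : polar (J x) (J y) = polar x y by rewrite /polar -JD !QJ.
have [n] := ubnP (\dim U); elim: n U => // n IHn U dimU JU JJ.
have [[x xU Qx]|[Q0 oU]] := isotropic_or_not U; last first.
  exists (vbasis U); split=> //; first exact: vbasisP.
    by rewrite (eq_in_count (a2 := pred0)) ?count_pred0 // => x /Q0->; rewrite eqxx.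
  exists 1; rewrite ?oner_neq0 // expr1n big_seq_cond big1 // => x /andP[/Q0->].
  by rewrite eqxx.
(* Applying the isometry J to both arguments gives polar (J x) (-x), so the value equals its own
   opposite. *)
have xJx : polar x (J x) = 0.
  have : polar x (J x) = - polar x (J x).
    by rewrite -{1}BJ JJ // polarNr polarC.
  by move/eqP; rewrite -subr_eq0 opprK -mulr2n -mulr_natl mulf_eq0 (negPf F2) => /eqP.
have [W WE] := exists_perp x; have [W' WE'] := exists_perp (J x).
have JxU : J x \in (U :&: W)%VS by rewrite memv_cap JU // WE xJx eqxx.
have QJx : Q (J x) != 0 by rewrite QJ.
have [|y|y|b [bU ob oddb [e e0 be]]] := IHn (U :&: W :&: W')%VS.
- apply: leq_trans (dim_cap_perp JxU QJx WE') _; rewrite -ltnS.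
  exact: ltn_trans (dim_cap_perp xU Qx WE) dimU.
(* J y is orthogonal to x because polar x (J y) = polar (J x) (J (J y)) = -polar (J x) y. *)
- rewrite !memv_cap !WE !WE' => /andP[/andP[yU xy] Jxy].
  rewrite JU //= BJ xy andbT -BJ JJ // polarNr oppr_eq0 //.
- by rewrite !memv_cap => /andP[/andP[yU _] _]; apply: JJ.
have [bUW obW] := orth_basis_cons JxU QJx WE' bU ob.
have [bUx obx] := orth_basis_cons xU Qx WE bUW obW.
exists [:: x, J x & b]; split=> //; first by rewrite /= Qx QJx /= negbK.
exists (Q x * e); rewrite ?mulf_neq0 // !big_cons Qx QJx QJ be; ring.
Qed.

(** The list [c] holds the diagonal coefficients of Q on [U], zeros included; later arguments
    manipulate only this list. *)
Definition has_orth_basis (U : {vspace V}) (c : seq F) : Prop :=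
  exists b, [/\ basis_of U b, orthogonal_seq b & map Q b = c].

Lemma has_orth_basis_perm (U : {vspace V}) (c c' : seq F) :
  perm_eq c' c -> has_orth_basis U c -> has_orth_basis U c'.
Proof.
move=> cc' [b [bU ob bc]]; have /(perm_iotaP 0)[Is IsP ->] := cc'.
have bE : perm_eq (map (nth 0 b) Is) b.
  apply/(perm_iotaP 0); exists Is => //.
  by rewrite -bc size_map in IsP.
exists (map (nth 0 b) Is); split.
- by rewrite (perm_basis _ bE).
- by move=> x y; rewrite !(perm_mem bE); apply: ob.
- rewrite -map_comp; apply/eq_in_map => i; rewrite (perm_mem IsP) mem_iota => /= iI.
  by rewrite -bc (nth_map 0) //; rewrite -bc size_map in iI.
Qed.

(** In the plane of x and y, the vector ux + vy has value 1, and -dv x + cu y is orthogonal to it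
    with value cd(cu^2 + dv^2) = cd. *)
Lemma has_orth_basis_pair (U : {vspace V}) (c d u v : F) (l : seq F) :
  c * u ^+ 2 + d * v ^+ 2 = 1 ->
  has_orth_basis U [:: c, d & l] -> has_orth_basis U [:: 1, c * d & l].
Proof.
move=> cd1 [[|x [|y b]] [bU ob] //= [Qx Qy bl]].
have uniqb := free_uniq (basis_free bU).
have /= := uniqb; rewrite inE negb_or => /and3P[/andP[xy xb] yb _].
have Bxy : polar x y = 0 by apply: ob; rewrite ?inE ?eqxx ?orbT.
have Bx z : z \in b -> polar x z = 0.
  by move=> zb; apply: ob; rewrite ?inE ?eqxx ?zb ?orbT //; apply: contraNneq xb => ->.
have By z : z \in b -> polar y z = 0.
  by move=> zb; apply: ob; rewrite ?inE ?eqxx ?zb ?orbT //; apply: contraNneq yb => ->.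
have Qxy s t : Q (s *: x + t *: y) = c * s ^+ 2 + d * t ^+ 2.
  rewrite [LHS](_ : _ = Q (s *: x) + Q (t *: y) + polar (s *: x) (t *: y)); last first.
    by rewrite /polar; ring.
  by rewrite !quadratic_formZ polarZl polarZr Bxy Qx Qy; ring.
pose x' := u *: x + v *: y; pose y' := (- d * v) *: x + (c * u) *: y.
exists [:: x', y' & b]; split.
- move: bU; rewrite !basisEdim /= => /andP[Ub ->]; rewrite andbT.
  apply: subv_trans Ub _; apply/span_subvP => z.
  have memx' : x' \in <<[:: x', y' & b]>>%VS.
    by rewrite memv_span ?inE ?eqxx.
  have memy' : y' \in <<[:: x', y' & b]>>%VS.
    by rewrite memv_span ?inE ?eqxx ?orbT.
  rewrite !inE => /or3P[/eqP->|/eqP->|zb].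
  (* The change of basis has determinant cu^2 + dv^2 = 1; its inverse expresses x and y through x'
     and y'. *)
  + rewrite (_ : x = (c * u) *: x' - v *: y').
      by rewrite rpredB ?rpredZ.
    rewrite /x' /y' !scalerDr !scalerA opprD addrACA -!scaleNr -!scalerDl.
    rewrite (_ : _ + _ = 1 :> F); last by rewrite -cd1; ring.
    by rewrite scale1r (_ : _ + _ = 0 :> F) ?scale0r ?addr0 //; ring.
  + rewrite (_ : y = (d * v) *: x' + u *: y').
      by rewrite rpredD ?rpredZ.
    rewrite /x' /y' !scalerDr !scalerA addrACA -!scalerDl.
    rewrite (_ : d * v * v + _ = 1 :> F); last by rewrite -cd1; ring.
    by rewrite scale1r (_ : _ + _ = 0 :> F) ?scale0r ?add0r //; ring.
  + by rewrite memv_span // !inE zb !orbT.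
- have B' : polar x' y' = 0.
    rewrite /x' /y' !polarDl !polarDr !polarZl !polarZr !polarxx (polarC y) Bxy Qx Qy; ring.
  have Bb s t z : z \in b -> polar (s *: x + t *: y) z = 0.
    by move=> zb; rewrite polarDl !polarZl Bx // By // !mulr0 addr0.
  move=> w z; rewrite !inE.
  case/or3P=> [/eqP->|/eqP->|wb] /or3P[/eqP->|/eqP->|zb] //; rewrite ?eqxx // => wz.
  + exact: Bb.
  + by rewrite polarC.
  + exact: Bb.
  + by rewrite polarC; apply: Bb.
  + by rewrite polarC; apply: Bb.
  + by apply: ob; rewrite ?inE ?wb ?zb ?orbT.
- rewrite /= /x' /y' !Qxy bl cd1; congr [:: _, _ & _].
  by rewrite -[RHS]mulr1 -cd1; ring.
Qed.

End OrthogonalBases.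

(** * Rank and type from an orthogonal basis *)

(* Otherwise (1 - d v^2) / c is a nonsquare for every v, so that the polynomial
   ((1 - d X^2) / c)^((|F| - 1) / 2) + 1, of degree |F| - 1, has |F| roots. *)
Lemma binary_form_represents1 (F : finFieldType) (c d : F) :
  odd #|F| -> c != 0 -> d != 0 -> exists u v, c * u ^+ 2 + d * v ^+ 2 = 1.
Proof.
move=> oddF c0 d0; have F1 : (1 < #|F|)%N := finNzRing_gt1 F.
have [/existsP[u /existsP[v /eqP uv]]|no] :=
  boolP [exists u, exists v, c * u ^+ 2 + d * v ^+ 2 == 1]; first by exists u, v.
have {}no u v : c * u ^+ 2 + d * v ^+ 2 != 1.
  by apply: contra no => uv; apply/existsP; exists u; apply/existsP; exists v.
pose m := (#|F|.-1 %/ 2)%N.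
have mE : (2 * m).+1 = #|F| by rewrite /m; lia.
have m0 : (0 < m)%N by lia.
pose q : {poly F} := - (d / c) *: 'X^2 + (c^-1)%:P.
pose P := q ^+ m + 1.
have sq : size q = 3.
  rewrite size_polyDl ?size_scale ?size_polyXn ?oppr_eq0 ?mulf_neq0 ?invr_eq0 //.
  by rewrite size_polyC; case: (_ != _).
have sP : size P = #|F|.
  have := size_exp q m; rewrite sq /= => h.
  have sqm : size (q ^+ m) = (2 * m).+1.
    rewrite -h prednK // lt0n size_poly_eq0 expf_neq0 //.
    by rewrite -size_poly_eq0 sq.
  by rewrite size_polyDl sqm // size_poly1; lia.
have P0 : P != 0 by rewrite -size_poly_eq0 sP; lia.
have rootP v : root P v.
  have qv : q.[v] = - (d / c) * v ^+ 2 + c^-1 by rewrite /q hornerD hornerZ hornerXn hornerC.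
  rewrite rootE /P -polyC1 hornerD horner_exp qv hornerC.
  (* If [q] vanished at v, then d v^2 = 1 and the pair (0, v) would represent 1. *)
  have w0 : - (d / c) * v ^+ 2 + c^-1 != 0.
    apply: contra_neq (no 0 v) => w0.
    rewrite (_ : 1 = c * (- (d / c) * v ^+ 2 + c^-1) + d * v ^+ 2); last by field.
    by rewrite w0; ring.
  have /orP[/eqP w1|/eqP->] := expf_half_card oddF w0; last by rewrite addNr.
  have := euler_criterion oddF w0; rewrite w1 eqxx => /existsP[u /eqP uw].
  by case/eqP: (no u v); rewrite uw; field.
have rootsP : all (root P) (enum F) by apply/allP.
by have := max_poly_roots P0 rootsP (enum_uniq F); rewrite sP -cardE ltnn.
Qed.

Lemma prod_nz_neq0 (F : fieldType) (c : seq F) : \prod_(x <- c | x != 0) x != 0.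
Proof. by rewrite prodf_seq_neq0; apply/allP => x _; rewrite implybb. Qed.

Section PrimeForms.

Variables (p : nat) (V : vectType 'F_p) (Q : V -> 'F_p).
Hypotheses (p_pr : prime p) (p_odd : odd p) (quadQ : quadratic_form Q).

Let F2 : (2 : 'F_p) != 0 := two_neq0 p_pr p_odd.

(** A binary form with nonzero coefficients d, c represents 1, so it can be replaced by 1, dc;
    iteration collects the product of all nonzero values in one coefficient. *)
Lemma has_orth_basis_normal (U : {vspace V}) (d : 'F_p) (l z : seq 'F_p) :
  d != 0 -> all (fun x => x != 0) l ->
  has_orth_basis Q U (d :: l ++ z) ->
  has_orth_basis Q U (d * \prod_(x <- l) x :: nseq (size l) 1 ++ z).
Proof.
elim: l d z => [|c l IHl] d z d0 /=; first by rewrite big_nil mulr1.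
case/andP=> c0 l0 hb.
have oddF : odd #|'F_p| by rewrite card_Fp.
have [u [v uv]] := binary_form_represents1 oddF d0 c0.
have {}hb := has_orth_basis_pair quadQ uv hb.
rewrite big_cons mulrA.
(* The new coefficient 1 joins the tail [z], which brings the list into the form of the induction
   hypothesis. *)
apply: (@has_orth_basis_perm _ _ _ _
  (d * c * \prod_(x <- l) x :: nseq (size l) 1 ++ (1 :: z))).
  by rewrite perm_cons; apply/permPl/(perm_catCA [:: 1]).
apply: IHl; rewrite ?mulf_neq0 //; apply: has_orth_basis_perm hb.
by apply/permPl; apply: (perm_catCA (d * c :: l) [:: 1]).
Qed.

(** Twice each side is the bilinear expansion of [polar] on the sum, where only diagonal terms
    survive. *)
Lemma quadratic_form_sum_orth (b : seq V) (x : nat -> 'F_p) :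
  uniq b -> orthogonal_seq Q b ->
  Q (\sum_(i < size b) x i *: b`_i) = \sum_(i < size b) x i ^+ 2 * Q b`_i.
Proof.
move=> ub ob; apply: (mulfI F2); rewrite -polarxx // polar_suml // mulr_sumr.
apply: eq_bigr => i _; rewrite polar_sumr // (bigD1 i) //= big1 => [|j ji].
  by rewrite polarZl // polarZr // polarxx //; ring.
rewrite polarZl // polarZr // ob ?mem_nth ?mulr0 //.
by rewrite nth_uniq // eq_sym.
Qed.

Let N := \dim {:V}.

(** The Gram matrix A of half the polar form does not depend on [M], so any two diagonalizations can
    be compared through it. *)
Lemma in_coords_gram :
  exists2 A : 'M['F_p]_N, A^T = A &
    forall (M : 'M_N) (c : seq 'F_p),
      (forall x, in_coords Q (x *m M) = \sum_(i < N) c`_i * x 0 i ^+ 2) ->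
      M *m A *m M^T = diag_mx (\row_i c`_i).
Proof.
pose v i := (vbasis {:V})`_i.
exists (\matrix_(i, j) (polar Q (v i) (v j) / 2)).
  by apply/matrixP=> i j; rewrite !mxE polarC.
move=> M c Mc.
pose w (x : 'rV_N) := \sum_(i < N) x 0 i *: v i.
have polw x y : polar Q (w x) (w y) / 2 =
    (x *m (\matrix_(i, j) (polar Q (v i) (v j) / 2)) *m y^T) 0 0.
  rewrite mxE polar_sumr // mulr_suml; apply: eq_bigr => j _.
  rewrite polarZr // polar_suml // !mxE mulr_sumr !mulr_suml.
  by apply: eq_bigr => i _; rewrite polarZl // !mxE; ring.
have wD x y : w (x + y) = w x + w y.
  by rewrite /w -big_split; apply: eq_bigr => i _; rewrite mxE scalerDl.
apply/matrixP=> i j.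
pose e k : 'rV['F_p]_N := delta_mx 0 k.
have -> : (M *m (\matrix_(i, j) (polar Q (v i) (v j) / 2)) *m M^T) i j =
    polar Q (w (e i *m M)) (w (e j *m M)) / 2.
  rewrite polw (_ : _ *m _ =
      e i *m (M *m (\matrix_(i, j) (polar Q (v i) (v j) / 2)) *m M^T) *m (e j)^T).
    by rewrite -rowE trmx_delta -colE !mxE.
  by rewrite trmx_mul !mulmxA.
(* The (i, j) entry comes from polarizing the diagonal expression at the unit vectors [e i] and
   [e j]. *)
rewrite /polar -wD -mulmxDl -!/(in_coords Q _) !Mc.
rewrite -!sumrB mulr_suml (bigD1 i) //= big1 => [|k ki]; rewrite !mxE !eqxx /=.
  case: (eqVneq i j) => _; rewrite ?eqxx /= ?mulr1n ?mulr0n; first by field.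
  ring.
by rewrite (negPf ki) /=; ring.
Qed.

(** The rows of [M] are the coordinates of the orthogonal basis in [vbasis]; the reverse coordinates
    give its inverse. *)
Lemma orth_basis_coords (c : seq 'F_p) :
  has_orth_basis Q {:V} c ->
  size c = N /\ exists2 M, M \in unitmx &
    forall x, in_coords Q (x *m M) = \sum_(i < N) c`_i * x 0 i ^+ 2.
Proof.
case=> b [bV ob bc]; have sb : size b = N by rewrite /N (size_basis (X := in_tuple b) bV).
have sc : size c = N by rewrite -bc size_map.
split=> //.
pose bt : N.-tuple V := Tuple (introT eqP sb).
pose M : 'M['F_p]_N := \matrix_(i, j) coord (vbasis {:V}) j b`_i.
pose M' : 'M['F_p]_N := \matrix_(i, j) coord bt j (vbasis {:V})`_i.
have ME i : b`_i = \sum_j coord (vbasis {:V}) j b`_i *: (vbasis {:V})`_j.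
  exact: coord_vbasis (memvf _).
have M'E i : (vbasis {:V})`_i = \sum_j coord bt j (vbasis {:V})`_i *: b`_j.
  exact: (coord_basis (X := bt) bV (memvf _)).
have MM' : M' *m M = 1%:M.
  apply/matrixP=> i j; rewrite !mxE.
  transitivity (coord (vbasis {:V}) j (vbasis {:V})`_i); last first.
    by rewrite coord_free // (basis_free (vbasisP _)).
  rewrite [in RHS]M'E linear_sum /=; apply: eq_bigr => k _.
  by rewrite linearZ !mxE.
exists M; first by case/mulmx1_unit: MM'.
move=> x; rewrite /in_coords.
(* The coordinates are extended by 0 to all indices, since the next sum runs to [size b] rather than
   to N. *)
pose xn k := if insub k is Some j then x 0 j else 0.
rewrite (_ : \sum_(i < _) _ = \sum_(i < size b) xn i *: b`_i).
  rewrite quadratic_form_sum_orth //; last first.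
    exact: free_uniq (basis_free bV).
  rewrite sb; apply: eq_bigr => i _; rewrite /xn valK mulrC -bc (nth_map 0) ?sb //.
rewrite [in RHS]sb; under [RHS]eq_bigr => i _ do rewrite /xn valK ME scaler_sumr.
rewrite exchange_big; apply: eq_bigr => j _ /=; rewrite mxE scaler_suml.
by apply: eq_bigr => i _; rewrite !mxE scalerA.
Qed.

(** The coefficient list of [diag_form]; in rank 0 the scalar d does not occur. *)
Let diag_seq r (d : 'F_p) : seq 'F_p :=
  if r is r'.+1 then nseq r' 1 ++ d :: nseq (N - r) 0 else nseq N 0.

Lemma diag_form_seq r (d : 'F_p) (x : 'rV['F_p]_N) :
  diag_form r d x = \sum_(i < N) (diag_seq r d)`_i * x 0 i ^+ 2.
Proof.
rewrite /diag_form big_mkcond [X in _ + X]big_mkcond -big_split.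
apply: eq_bigr => i _ /=; case: r => [|r]; first by rewrite nth_nseq if_same mul0r addr0.
rewrite ltnS eqSS /= nth_cat size_nseq nth_nseq.
case: ltngtP => [_|ri|->]; rewrite ?mul1r ?addr0 ?add0r ?subnn //.
by rewrite -[(i - r)%N]prednK ?subn_gt0 //= nth_nseq if_same mul0r.
Qed.

Lemma has_diag_formP r (d : 'F_p) :
  reflect (d != 0 /\ exists2 M, M \in unitmx &
             forall x, in_coords Q (x *m M) = \sum_(i < N) (diag_seq r d)`_i * x 0 i ^+ 2)
          (has_diag_form Q r d).
Proof.
apply: (iffP andP) => [[d0 /existsP[M /andP[uM /forallP hM]]]|[d0 [M uM hM]]].
  by split=> //; exists M => // x; rewrite -diag_form_seq; apply/eqP.
split=> //; apply/existsP; exists M; rewrite uM /=.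
by apply/forallP=> x; rewrite hM diag_form_seq.
Qed.

Lemma has_diag_form_orth_basis r (d : 'F_p) :
  d != 0 -> has_orth_basis Q {:V} (diag_seq r d) -> has_diag_form Q r d.
Proof. by move=> d0 /orth_basis_coords[_ hM]; apply/has_diag_formP. Qed.

Lemma exists_diagonalization (c : seq 'F_p) :
  has_orth_basis Q {:V} c -> exists r d, (r <= N)%N /\ has_diag_form Q r d.
Proof.
move=> hc; have [sc _] := orth_basis_coords hc.
pose l := [seq x <- c | x != 0]; pose z := nseq (size c - size l) (0 : 'F_p).
have cE : perm_eq (l ++ z) c.
  rewrite (_ : z = [seq x <- c | predC (fun x : 'F_p => x != 0) x]).
    by apply/permPl/perm_filterC.
  have -> : z = nseq (size [seq x <- c | predC (fun x : 'F_p => x != 0) x]) 0.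
    rewrite /z /l !size_filter; congr (nseq _ _).
    by rewrite -(count_predC (fun x : 'F_p => x != 0) c) addKn.
  apply/esym/all_pred1P; rewrite all_filter; apply/allP=> x _ /=.
  by rewrite negbK implybb.
have := has_orth_basis_perm cE hc.
have l0 : all (fun x => x != 0) l by apply: filter_all.
have sl : (size l <= N)%N by rewrite -sc size_filter count_size.
rewrite /z; case: l l0 sl {cE z} => [_ _|d l /= /andP[d0 l0] sl].
  (* With no nonzero coefficient the rank is 0, and 1 serves as an arbitrary nonzero d. *)
  rewrite subn0 sc => h; exists 0%N, 1; split=> //.
  by apply: has_diag_form_orth_basis; rewrite ?oner_neq0.
move/(has_orth_basis_normal d0 l0) => h.
exists (size l).+1, (d * \prod_(x <- l) x); split=> //.
apply: has_diag_form_orth_basis.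
  by rewrite mulf_neq0 // prodf_seq_neq0; apply: sub_all l0 => x ->; rewrite implybT.
apply: has_orth_basis_perm h; rewrite sc.
by apply/permPl; apply: (perm_catCA _ [:: _]).
Qed.

Lemma card_row_support (c : seq 'F_p) :
  size c = N -> #|[set i | (\row_(i < N) c`_i) 0 i != 0]| = count (fun x => x != 0) c.
Proof.
move=> sc; rewrite cardsE -sum1_card -sum1_count (big_nth 0) sc big_mkord.
by apply: eq_bigl => i; rewrite unfold_in mxE.
Qed.

Lemma prod_row_support (c : seq 'F_p) :
  size c = N ->
  \prod_(i in [set i | (\row_(i < N) c`_i) 0 i != 0]) (\row_(i < N) c`_i) 0 i =
  \prod_(x <- c | x != 0) x.
Proof.
move=> sc; rewrite [RHS](big_nth 0) sc big_mkord.
by apply: eq_big => i; rewrite ?inE mxE.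
Qed.

(** The diagonalization picked in the definitions and the given basis diagonalize the same Gram
    matrix, so the counts agree and the products differ by a nonzero square. *)
Lemma qf_invariants (c : seq 'F_p) :
  has_orth_basis Q {:V} c ->
  qf_rank Q = count (fun x => x != 0) c /\
  qf_type Q = quadratic_char (\prod_(x <- c | x != 0) x).
Proof.
move=> hc; have [sc [M uM hM]] := orth_basis_coords hc.
rewrite /qf_rank /qf_type /diagonalization.
case: pickP => [[r d] /= /has_diag_formP[d0 [M' uM' hM']]|none]; last first.
  have [r [d [rN]]] := exists_diagonalization hc.
  by have := none (inord r, d); rewrite /= inordK // => ->.
have [A _ gramA] := in_coords_gram.
have := gramA M' _ hM'.
have -> : M' *m A *m M'^T = (M' *m invmx M) *m (M *m A *m M^T) *m (M' *m invmx M)^T.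
  by rewrite trmx_mul trmx_inv !mulmxA mulmxKV // -!mulmxA mulKVmx ?unitmx_tr.
have sd : size (diag_seq r d) = N.
  case: r {hM'} => [[|r] rN] /=; first by rewrite size_nseq.
  by rewrite size_cat /= !size_nseq addnS -addSn subnKC.
rewrite (gramA M _ hM) => /congruent_diag[|].
  by rewrite unitmx_mul uM' unitmx_inv.
rewrite !card_row_support // !prod_row_support // => <- [e e0 prodE].
have ->: quadratic_char (\prod_(x <- c | x != 0) x)
       = quadratic_char (\prod_(x <- diag_seq r d | x != 0) x).
  by rewrite prodE quadratic_charM ?expf_neq0 ?prod_nz_neq0 // quadratic_char_sqr // mul1r.
(* In rank 0 the product is empty, in agreement with the type 1 assigned to the zero form. *)
case: r {hM' sd prodE} => [[|r] rN] /=.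
  by rewrite count_nseq eqxx mul0n big_nseq_cond eqxx quadratic_char1.
rewrite count_cat /= d0 !count_nseq eqxx oner_neq0 mul0n mul1n addn0 addn1.
rewrite big_cat big_cons d0 big1_seq => [|x /andP[_ /nseqP[-> _]]] //.
rewrite big1_seq => [|x /andP[x0 /nseqP[x00 _]]]; last by rewrite x00 eqxx in x0.
by rewrite /= mul1r mulr1.
Qed.

End PrimeForms.

(** * Trace forms *)

Lemma big_cycle (gT : finGroupType) (R : nmodType) (g : gT) (G : gT -> R) :
  \sum_(h in <[g]>%g) G h = \sum_(i < #[g]%g) G (g ^+ i)%g.
Proof.
have -> : <[g]>%g = [set (g ^+ (i : nat))%g | i : 'I_#[g]%g].
  apply/setP=> h; apply/idP/imsetP => [/cyclePmin[i ig ->]|[i _ ->]].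
    by exists (Ordinal ig).
  exact: mem_cycle.
rewrite big_imset //= => i j _ _ /eqP.
by rewrite eq_expg_mod_order !modn_small // => /eqP/val_inj.
Qed.

Section Trace.

Variables (p : nat) (L : splittingFieldType 'F_p).
Hypothesis p_pr : prime p.

Lemma pchar_ext : p \in [pchar L].
Proof. by rewrite (pchar_lalg L) pchar_Fp. Qed.

Lemma exprD_pk k (x y : L) : (x + y) ^+ (p ^ k) = x ^+ (p ^ k) + y ^+ (p ^ k).
Proof.
apply: exprDn_pchar; rewrite pnatX; apply/orP; left.
by rewrite pnatE // pchar_ext.
Qed.

Lemma expr_sum_pk k (I : finType) (f : I -> L) :
  (\sum_i f i) ^+ (p ^ k) = \sum_i f i ^+ (p ^ k).
Proof.
apply: (big_morph (fun x => x ^+ (p ^ k)) (exprD_pk k)).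
by rewrite expr0n gtn_eqF // expn_gt0 prime_gt0.
Qed.

Lemma exprZ_pk k (c : 'F_p) (x : L) : (c *: x) ^+ (p ^ k) = c *: x ^+ (p ^ k).
Proof.
rewrite exprZn; congr (_ *: _); elim: k => [|k IHk]; first by rewrite expn0 expr1.
by rewrite expnSr exprM IHk; have := expf_card c; rewrite card_Fp.
Qed.

Lemma expr_dim (x : L) : x ^+ (p ^ \dim {:L}) = x.
Proof.
apply/eqP; have := Fermat's_little_theorem (aspacef L) x.
by rewrite memvf card_Fp // => <-.
Qed.

(** The Galois group over the prime field is cyclic of order [\dim {:L}], generated by the
    p-Frobenius. *)
Lemma galTrace_sum (x : L) : galTrace 1 {:L} x = \sum_(i < \dim {:L}) x ^+ (p ^ i).
Proof.
have sub1L : (1 <= {:L})%VS by apply: subvf.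
have [g genG gE] := finField_galois_generator (K := aspace1 L) (E := aspacef L) sub1L.
have defG : 'Gal({:L} / 1)%g = <[g]>%g by apply/eqP.
have og : #[g]%g = \dim {:L}.
  have := galois_dim (finField_galois (K := aspace1 L) (E := aspacef L) sub1L).
  by rewrite dimv1 divn1 defG orderE.
rewrite /galTrace defG big_cycle og; apply: eq_bigr => i _.
elim: (i : nat) => [|j IHj]; first by rewrite expg0 gal_id expr1.
rewrite expgSr galM ?memvf // IHj gE ?memvf // dimv1 expn1 card_Fp //.
by rewrite -exprM -expnSr.
Qed.

(** The extension is Galois, so the trace lies in the prime field and the default 0 of [abs_trace]
    is not reached. *)
Lemma abs_traceE (x : L) : (abs_trace x)%:A = \sum_(i < \dim {:L}) x ^+ (p ^ i).
Proof.
have : galTrace 1 {:L} x \in 1%VS.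
  apply: (mem_galTrace (K := aspace1 L) (E := aspacef L)); last exact: memvf.
  exact/finField_galois/subvf.
case/vlineP => c cE; rewrite -galTrace_sum /abs_trace.
by case: pickP => [d /eqP //|/(_ c)]; rewrite cE eqxx.
Qed.

Lemma in_alg_inj : injective (fun c : 'F_p => c%:A : L).
Proof. exact: (fmorph_inj (in_alg L)). Qed.

Lemma abs_tracePl (c : 'F_p) (x y : L) :
  abs_trace (c *: x + y) = c * abs_trace x + abs_trace y.
Proof.
apply: in_alg_inj; rewrite scalerDl -scalerA !abs_traceE scaler_sumr -big_split.
by apply: eq_bigr => i _; rewrite exprD_pk exprZ_pk.
Qed.

Lemma abs_traceD (x y : L) : abs_trace (x + y) = abs_trace x + abs_trace y.
Proof. by rewrite -[x]scale1r abs_tracePl scale1r mul1r. Qed.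

Lemma abs_trace0 : abs_trace (0 : L) = 0.
Proof. by have := abs_tracePl (-1) 0 0; rewrite scaler0 addr0 mulN1r addNr. Qed.

Lemma abs_traceZ (c : 'F_p) (x : L) : abs_trace (c *: x) = c * abs_trace x.
Proof. by rewrite -[c *: x]addr0 abs_tracePl abs_trace0 addr0. Qed.

Lemma abs_traceB (x y : L) : abs_trace (x - y) = abs_trace x - abs_trace y.
Proof. by rewrite abs_traceD -scaleN1r abs_traceZ mulN1r. Qed.

(** Frobenius permutes the terms of the trace cyclically. *)
Lemma abs_trace_pk k (x : L) : abs_trace (x ^+ (p ^ k)) = abs_trace x.
Proof.
elim: k => [|k IHk]; first by rewrite expn0 expr1.
rewrite expnSr exprM -IHk; move: (x ^+ _) => y; apply: in_alg_inj; rewrite !abs_traceE.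
case: (\dim {:L}) (expr_dim y) => [|N] yN; first by rewrite !big_ord0.
rewrite big_ord_recr [RHS]big_ord_recl /= -exprM -expnS yN expn0 expr1 addrC.
by congr (_ + _); apply: eq_bigr => i _; rewrite -exprM -expnS.
Qed.

Variables (k : nat) (alpha : 'I_k.+1 -> nat).

(** Dembowski-Ostrom polynomials have exponents p^i + p^j; here one of the two powers is 1. *)
Definition dembowski_ostrom (c : 'I_k.+1 -> L) (x : L) : L :=
  \sum_i c i * x ^+ (p ^ alpha i + 1).

(** Polarizing c x^(p^j + 1) gives c(x^(p^j) y + x y^(p^j)), which is linear over the prime field in
    each variable. *)
Lemma quadratic_dembowski_ostrom (c : 'I_k.+1 -> L) (Q : L -> 'F_p) :
  (forall x, Q x = abs_trace (dembowski_ostrom c x)) -> quadratic_form Q.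
Proof.
move=> QE; have polE x y : polar Q x y =
    abs_trace (\sum_i c i * (x ^+ (p ^ alpha i) * y + x * y ^+ (p ^ alpha i))).
  rewrite /polar !QE -!abs_traceB; congr abs_trace; rewrite -!sumrB.
  by apply: eq_bigr => i _; rewrite !addn1 !exprSr exprD_pk; ring.
split=> [a x|a x y z].
  rewrite !QE -abs_traceZ scaler_sumr; congr abs_trace; apply: eq_bigr => i _.
  by rewrite !addn1 !(exprSr _ (p ^ _)) exprZ_pk // -!scalerAl -!scalerAr -?scalerAl scalerA.
rewrite !polE -abs_tracePl; congr abs_trace.
rewrite scaler_sumr -big_split; apply: eq_bigr => i _ /=.
rewrite exprD_pk // exprZ_pk // !mulrDl -!scalerAl.
by rewrite [X in c i * X]addrACA -scalerDr mulrDr -scalerAr.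
Qed.

End Trace.

Section TraceExtension.

Variables (p : nat) (K L : splittingFieldType 'F_p) (iota : {rmorphism K -> L}).
Hypothesis p_pr : prime p.

Lemma rmorph_scale_Fp (c : 'F_p) (x : K) : iota (c *: x) = c *: iota x.
Proof.
rewrite -[c in LHS]natr_Zp -[c in RHS]natr_Zp !scaler_nat; exact: rmorphMn.
Qed.

(** The powers y^(p^i) repeat with period [\dim {:K}], so the sum over L runs m times through that
    over K. *)
Lemma abs_trace_ext m (y : K) :
  \dim {:L} = (m * \dim {:K})%N -> abs_trace (iota y) = m%:R * abs_trace y.
Proof.
move=> dimL; apply: (in_alg_inj (L := L)); rewrite abs_traceE // dimL -scalerA.
have -> : (abs_trace y)%:A = iota (abs_trace y)%:A by rewrite rmorph_scale_Fp rmorph1.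
rewrite abs_traceE // scaler_nat rmorph_sum /=.
elim: m {dimL} => [|m IHm]; first by rewrite mulr0n mul0n big_ord0.
rewrite mulSn big_split_ord /= mulrS; congr (_ + _).
  by apply: eq_bigr => i _; rewrite rmorphXn.
rewrite -IHm; apply: eq_bigr => i _.
by rewrite expnD exprM -rmorphXn expr_dim.
Qed.

Lemma trace_formE k (alpha : 'I_k.+1 -> nat) (a : 'I_k.+1 -> K) (x : L) :
  trace_form iota (\sum_i a i *: 'X^(p ^ alpha i + 1)) x =
  abs_trace (dembowski_ostrom alpha (iota \o a) x).
Proof.
rewrite /trace_form rmorph_sum /= horner_sum; congr abs_trace.
by apply: eq_bigr => i _; rewrite map_polyZ map_polyXn hornerZ hornerXn.
Qed.

End TraceExtension.

(** * Decomposition of the form over the extension *)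

(** On [U] the map sigma is an involution, and x = (x + sigma x)/2 + (x - sigma x)/2 splits it into
    eigenspaces. They are orthogonal, as an isometry sends polar x y to its opposite there. *)
Lemma involution_orth_basis (F : fieldType) (V : vectType F) (Q : V -> F)
    (sigma : V -> V) (U U1 W : {vspace V}) (c c' : seq F) :
  (2 : F) != 0 -> quadratic_form Q ->
  (forall a x y, sigma (a *: x + y) = a *: sigma x + sigma y) ->
  (forall x, Q (sigma x) = Q x) ->
  (forall x, (x \in U) = (sigma (sigma x) == x)) ->
  (forall x, (x \in U1) = (sigma x == x)) ->
  (forall x, (x \in W) = (sigma x == - x)) ->
  has_orth_basis Q U1 c -> has_orth_basis Q W c' -> has_orth_basis Q U (c ++ c').
Proof.
move=> F2 quadQ lin iso UE U1E WE [b [bU1 ob bc]] [b' [bW ob' bc']].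
have sD x y : sigma (x + y) = sigma x + sigma y by rewrite -[x]scale1r lin !scale1r.
have s0 : sigma 0 = 0 by apply: (addIr (sigma 0)); rewrite -sD !add0r.
have sZ a x : sigma (a *: x) = a *: sigma x by rewrite -[a *: x]addr0 lin s0 addr0.
have sN x : sigma (- x) = - sigma x by rewrite -scaleN1r sZ scaleN1r.
have eq0 (x : V) : x = - x -> x = 0.
  move/eqP; rewrite -addr_eq0 -mulr2n -scaler_nat scaler_eq0 (negPf F2).
  by move/eqP.
have ->: U = (U1 + W)%VS.
  apply/vspaceP => x; rewrite UE; apply/eqP/memv_addP => [xx|[y + [z + ->]]]; last first.
    by rewrite U1E WE => /eqP yy /eqP zz; rewrite !(sD, yy, zz, sN) opprK.
  exists (2^-1 *: (x + sigma x)); first by rewrite U1E sZ sD xx addrC.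
  exists (2^-1 *: (x - sigma x)); first by rewrite WE sZ sD sN xx -scalerN opprB.
  rewrite -scalerDr addrACA subrr addr0 -mulr2n -scaler_nat scalerA mulVf //.
  by rewrite scale1r.
have [||bUW obUW] := orth_basis_cat _ _ bU1 bW ob ob'.
- apply/eqP; rewrite -subv0; apply/subvP => x; rewrite memv_cap U1E WE memv0.
  by case/andP=> /eqP -> /eqP/eq0 ->.
- move=> x y; rewrite U1E WE => /eqP xx /eqP yy.
  have : polar Q x y = polar Q (sigma x) (sigma y) by rewrite /polar -sD !iso.
  rewrite xx yy polarNr //.
  by move/eqP; rewrite -addr_eq0 -mulr2n -mulr_natl mulf_eq0 (negPf F2) => /eqP.
by exists (b ++ b'); rewrite map_cat bc bc'.
Qed.

Lemma image_orth_basis (F : fieldType) (V V' : vectType F) (Q : V -> F) (Q' : V' -> F)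
    (phi : {linear V -> V'}) (lambda : F) (U : {vspace V'}) (c : seq F) :
  injective phi -> (forall x, Q' (phi x) = lambda * Q x) ->
  (forall x, x \in U <-> exists y, x = phi y) ->
  has_orth_basis Q {:V} c -> has_orth_basis Q' U [seq lambda * x | x <- c].
Proof.
move=> injphi Qphi UE [b [bV ob bc]]; exists (map phi b); split.
- have ->: U = (linfun phi @: {:V})%VS.
    apply/vspaceP=> x; apply/idP/memv_imgP => [/UE[y ->]|[y _ ->]].
      by exists y; rewrite ?memvf ?lfunE.
    by apply/UE; exists y; rewrite lfunE.
  rewrite (eq_map (g := linfun phi)); last by move=> x; rewrite lfunE.
  apply: limg_basis_of bV; apply/eqP; rewrite -subv0; apply/subvP=> x.
  rewrite memv_cap memv_ker lfunE memv0 => /andP[_]; rewrite -(linear0 phi).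
  by move/eqP/injphi->.
- move=> _ _ /mapP[x xb ->] /mapP[y yb ->] xy.
  rewrite /polar -linearD !Qphi -!mulrBr -/(polar Q x y) ob ?mulr0 //.
  by apply: contra_neq xy => ->.
- by rewrite -bc -!map_comp; apply: eq_map => x /=; rewrite Qphi.
Qed.

(** * Square roots and fixed elements in finite extensions *)

Section FiniteExtension.

Variables (p : nat) (K : splittingFieldType 'F_p).
Hypotheses (p_pr : prime p) (p_odd : odd p).

Let n := \dim {:K}.

Lemma card_finvect : #|finvect_type K| = (p ^ n)%N.
Proof.
pose cK := Vector.class (finvect_type K : vectType 'F_p).
by rewrite -(card_vspacef cK) card_vspace card_Fp.
Qed.

Lemma expr_dim_mul j (y : K) : y ^+ (p ^ (n * j)) = y.
Proof.
elim: j => [|j IHj]; first by rewrite muln0 expr1.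
by rewrite mulnS expnD exprM expr_dim.
Qed.

Lemma exists_sqrt (y : K) : y != 0 ->
  y ^+ ((p ^ n).-1 %/ 2) = 1 -> exists x, x ^+ 2 = y.
Proof.
move=> y0 y1; have oddK : odd #|finvect_type K|.
  by rewrite card_finvect oddX p_odd orbT.
have := @euler_criterion (finvect_type K) y oddK y0.
rewrite card_finvect y1 eqxx => /existsP[x /eqP xy]; by exists x.
Qed.

Variables (L : splittingFieldType 'F_p) (iota : {rmorphism K -> L}).

(** Over K, X^q - X is the product of all X - y; evaluated at x in L it vanishes, so some factor x -
    iota y is zero. *)
Lemma fixed_in_image (x : L) : x ^+ (p ^ n) = x -> exists y, x = iota y.
Proof.
move=> xx.
have := congr1 (fun q : {poly K} => (map_poly iota q).[x]) (finField_genPoly (finvect_type K)).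
rewrite card_finvect /= rmorphB rmorph_prod /= map_polyXn map_polyX !hornerE xx subrr.
rewrite horner_prod => /esym/eqP; rewrite prodf_seq_eq0 => /hasP[y _ /=].
rewrite rmorphB /= map_polyX map_polyC !hornerE subr_eq0 => /eqP ->.
by exists y.
Qed.

End FiniteExtension.

Lemma qf_rank_le (p : nat) (V : vectType 'F_p) (Q : V -> 'F_p) :
  (qf_rank Q <= \dim {:V})%N.
Proof. by rewrite /qf_rank; case: diagonalization => // [[r _]]; rewrite -ltnS. Qed.

Lemma count_scale (F : fieldType) (e : F) (c : seq F) : e != 0 ->
  count (fun x => x != 0) [seq e * x | x <- c] = count (fun x => x != 0) c.
Proof.
by move=> e0; rewrite count_map; apply: eq_count => x /=; rewrite mulf_eq0 (negPf e0).
Qed.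

Lemma prod_scale (F : fieldType) (e : F) (c : seq F) : e != 0 ->
  \prod_(x <- [seq e * x | x <- c] | x != 0) x =
  e ^+ count (fun x => x != 0) c * \prod_(x <- c | x != 0) x.
Proof.
move=> e0; rewrite big_map (eq_bigl (fun x => x != 0)); last first.
  by move=> x; rewrite mulf_eq0 (negPf e0).
by rewrite big_split big_const_seq iter_mulr_1.
Qed.

(** For q = 2v + 1, (q^2 - 1)/2 = 2v(v + 1) is a multiple of both q - 1 and 2. By the Euler
    criterion, elements of K and -1 thus become squares in L. *)
Lemma dvdn_pred_half_expn q t : odd q -> (1 < q)%N ->
  (q.-1 %| (q ^ (2 * t)).-1 %/ 2)%N /\ (2 %| (q ^ (2 * t)).-1 %/ 2)%N.
Proof.
move=> oq q1; have /dvdnP[u uE] := dvdn_pred_predX (q ^ 2) t.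
rewrite expnM uE; have [v qE] : exists v, q = v.*2.+1 by exists q./2; lia.
have -> : (u * (q ^ 2).-1 %/ 2 = u * (v * (v + 1) * 2))%N.
  by rewrite (_ : u * (q ^ 2).-1 = u * (v * (v + 1) * 2) * 2)%N ?mulnK // qE; nia.
split; last by rewrite mulnA dvdn_mull.
by apply/dvdnP; exists (u * (v + 1))%N; rewrite qE -muln2 /=; ring.
Qed.

Lemma eqn_mod2_odd a b : (a == b %[mod 2]) = ~~ odd (a + b).
Proof. by rewrite !modn2 oddD; do 2!case: odd. Qed.

(** * The trace form over an extension of degree 2^s *)

Section ExtensionTraceForm.

Variables (p k s : nat) (K L : splittingFieldType 'F_p) (iota : {rmorphism K -> L}).
Variables (alpha : 'I_k.+1 -> nat) (a : 'I_k.+1 -> K) (beta : K).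
Hypotheses (p_pr : prime p) (p_odd : odd p) (s_gt0 : (0 < s)%N).

Let n := \dim {:K}.

Hypotheses (dimL : \dim {:L} = (2 ^ s * n)%N) (nonsq : forall y : K, y ^+ 2 != beta).

Let F2 : (2 : 'F_p) != 0 := two_neq0 p_pr p_odd.

Let a' i := a i * beta ^+ ((p ^ alpha i + 1) %/ 2).
Let Q : L -> 'F_p := trace_form iota (\sum_i a i *: 'X^(p ^ alpha i + 1)).
Let Q0 : K -> 'F_p :=
  trace_form (idfun : {rmorphism K -> K}) (\sum_i a i *: 'X^(p ^ alpha i + 1)).
Let Q1 : K -> 'F_p :=
  trace_form (idfun : {rmorphism K -> K}) (\sum_i a' i *: 'X^(p ^ alpha i + 1)).

Let QE x : Q x = abs_trace (dembowski_ostrom alpha (iota \o a) x) := trace_formE iota alpha a x.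
Let Q0E x : Q0 x = abs_trace (dembowski_ostrom alpha a x) := trace_formE idfun alpha a x.
Let Q1E x : Q1 x = abs_trace (dembowski_ostrom alpha a' x) := trace_formE idfun alpha a' x.

Let quadQ : quadratic_form Q := quadratic_dembowski_ostrom p_pr QE.
Let quadQ0 : quadratic_form Q0 := quadratic_dembowski_ostrom p_pr Q0E.
Let quadQ1 : quadratic_form Q1 := quadratic_dembowski_ostrom p_pr Q1E.

(** The coefficients lie in K and are fixed by powers of the q-Frobenius, which therefore commutes
    with f; the trace absorbs it. *)
Lemma trace_form_frobenius j x : Q (x ^+ (p ^ (n * j))) = Q x.
Proof.
rewrite !QE -(abs_trace_pk p_pr (n * j) (dembowski_ostrom _ _ x)); congr abs_trace.
rewrite /dembowski_ostrom expr_sum_pk //; apply: eq_bigr => i _ /=.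
by rewrite exprMn -rmorphXn expr_dim_mul // -!exprM mulnC.
Qed.

Let n_gt0 : (0 < n)%N.
Proof. by rewrite /n adim_gt0. Qed.

Let odd_q : odd (p ^ n).
Proof. by rewrite oddX p_odd orbT. Qed.

Let q_gt1 : (1 < p ^ n)%N.
Proof. by rewrite -(exp1n n) ltn_exp2r // prime_gt1. Qed.

Let cardL : (p ^ \dim {:L} = (p ^ n) ^ (2 * 2 ^ s.-1))%N.
Proof. by rewrite dimL -expnS prednK // -expnM mulnC. Qed.

(** This supplies the i needed to evaluate the quadratic character at 2. *)
Lemma exists_imaginary_unit : exists i : L, i ^+ 2 = -1.
Proof.
apply: (exists_sqrt p_pr p_odd); first by rewrite oppr_eq0 oner_neq0.
rewrite cardL; have [_ /dvdnP[u ->]] := dvdn_pred_half_expn (2 ^ s.-1) odd_q q_gt1.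
by rewrite mulnC exprM sqrrN !expr1n.
Qed.

Let beta_neq0 : beta != 0.
Proof. by apply: contraTneq (nonsq 0) => ->; rewrite expr0n eqxx. Qed.

(** The q-Frobenius fixes beta, hence sends gamma to gamma or -gamma; a fixed gamma would lie in K
    and make beta a square there. *)
Lemma exists_sqrt_nonsquare :
  exists gamma : L, gamma ^+ 2 = iota beta /\ gamma ^+ (p ^ n) = - gamma.
Proof.
have [||gamma gE] := exists_sqrt (y := iota beta) p_pr p_odd; first by rewrite fmorph_eq0.
  rewrite cardL; have [/dvdnP[u ->] _] := dvdn_pred_half_expn (2 ^ s.-1) odd_q q_gt1.
  rewrite -rmorphXn mulnC exprM (_ : beta ^+ _ = 1) ?expr1n ?rmorph1 //.
  by apply: (mulfI beta_neq0); rewrite -exprS prednK ?expr_dim ?mulr1 // (ltnW q_gt1).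
exists gamma; split=> //.
have : (gamma ^+ (p ^ n)) ^+ 2 == gamma ^+ 2.
  by rewrite -exprM mulnC exprM gE -rmorphXn expr_dim.
rewrite eqf_sqr => /orP[/eqP gq|/eqP//].
have [y gy] := fixed_in_image p_pr iota gq; have := nonsq y.
by rewrite -(inj_eq (fmorph_inj iota)) rmorphXn -gy gE eqxx.
Qed.

Lemma exists_eigenspace j (e : 'F_p) :
  exists U : {vspace L}, forall x, (x \in U) = (x ^+ (p ^ j) == e *: x).
Proof.
pose g (x : L) := x ^+ (p ^ j) - e *: x.
have lin : linear g.
  move=> c x y; rewrite /g exprD_pk // exprZ_pk // scalerDr opprD addrACA.
  by rewrite scalerBr !scalerA mulrC.
pose G : {linear L -> L} := HB.pack g (GRing.isLinear.Build 'F_p L L _ g lin).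
by exists (lker (linfun G)) => x; rewrite memv_ker lfunE subr_eq0.
Qed.

Let two_s : (2 ^ s)%:R != 0 :> 'F_p.
Proof. by rewrite natrX expf_neq0. Qed.

(** Multiplication by gamma turns the coefficients a_i into a_i gamma^(p^alpha_i + 1), and the trace
    from L of an element of K is 2^s times its trace from K. *)
Lemma trace_form_image (gamma : L) (b : 'I_k.+1 -> K) (Q' : K -> 'F_p) (U : {vspace L}) c :
  gamma != 0 ->
  (forall y, Q' y = abs_trace (dembowski_ostrom alpha b y)) ->
  (forall i, iota (b i) = iota (a i) * gamma ^+ (p ^ alpha i + 1)) ->
  (forall x, x \in U <-> exists y, x = gamma * iota y) ->
  has_orth_basis Q' {:K} c -> has_orth_basis Q U [seq (2 ^ s)%:R * x | x <- c].
Proof.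
move=> g0 Q'E bE UE.
pose g (x : K) := gamma * iota x.
have lin : linear g.
  by move=> e x y; rewrite /g rmorphD rmorph_scale_Fp mulrDr scalerAr.
pose G : {linear K -> L} := HB.pack g (GRing.isLinear.Build 'F_p K L _ g lin).
apply: (image_orth_basis (phi := G)) => // [x y /(mulfI g0)/fmorph_inj//|y].
rewrite QE Q'E -(abs_trace_ext iota) //; congr abs_trace.
rewrite rmorph_sum; apply: eq_bigr => i _ /=.
by rewrite rmorphM rmorphXn bE /g exprMn; ring.
Qed.

(* On the eigenspaces of the q^(2^m)-Frobenius for -1, m > 0, the
   q^(2^(m-1))-Frobenius is an isometry of square -1. *)
Lemma orth_basis_fixed_space m (c0 : seq 'F_p) (U1 : {vspace L}) :
  (forall x, (x \in U1) = (x ^+ (p ^ (n * 2)) == x)) -> has_orth_basis Q U1 c0 ->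
  forall U : {vspace L}, (forall x, (x \in U) = (x ^+ (p ^ (n * 2 ^ m.+1)) == x)) ->
  exists c, [/\ has_orth_basis Q U (c0 ++ c), ~~ odd (count (fun x => x != 0) c) &
    exists2 e, e != 0 & \prod_(x <- c | x != 0) x = e ^+ 2].
Proof.
move=> U1E hc0; elim: m => [|m IHm] U UE.
  exists [::]; split=> //; last by exists 1; rewrite ?oner_neq0 // big_nil expr1n.
  rewrite cats0 (_ : U = U1) //; apply/vspaceP => x; by rewrite U1E UE expn1.
(* The q^(2^(m+1))-Frobenius is an involution on [U]: induction treats its fixed space, the isometry
   argument its eigenspace for -1. *)
have [U' U'E] := exists_eigenspace (n * 2 ^ m.+1) 1.
have [W WE] := exists_eigenspace (n * 2 ^ m.+1) (-1).
have [|c [hc oddc [e e0 ce]]] := IHm U'; first by move=> x; rewrite U'E scale1r.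
have twice j (x : L) : (x ^+ (p ^ (n * 2 ^ j))) ^+ (p ^ (n * 2 ^ j)) = x ^+ (p ^ (n * 2 ^ j.+1)).
  by rewrite -exprM -expnD -mulnDr addnn -mul2n -expnS.
have [|||x|b [bW ob oddb [e' e'0 be']]] := @exists_orth_basis_isometry
  _ _ Q F2 quadQ W (fun x => x ^+ (p ^ (n * 2 ^ m))).
- by move=> x y; rewrite exprD_pk.
- exact: trace_form_frobenius.
- move=> x; rewrite !WE => /eqP xW.
  by rewrite -exprM mulnC exprM xW exprZ_pk.
- by rewrite WE twice scaleN1r => /eqP.
exists (c ++ map Q b); split.
- rewrite catA; apply: (involution_orth_basis F2 quadQ
    (sigma := fun x => x ^+ (p ^ (n * 2 ^ m.+1))) (U1 := U') (W := W)) => //.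
  + by move=> e1 x y; rewrite exprD_pk // exprZ_pk.
  + exact: trace_form_frobenius.
  + by move=> x; rewrite UE twice.
  + by move=> x; rewrite U'E scale1r.
  + by move=> x; rewrite WE scaleN1r.
  + by exists b.
- by rewrite count_cat oddD (negPf oddc) count_map.
- exists (e * e'); first by rewrite mulf_neq0.
  by rewrite big_cat big_map /= ce be' exprMn.
Qed.

Lemma orth_basis_trace_form (c0 c1 : seq 'F_p) :
  has_orth_basis Q0 {:K} c0 -> has_orth_basis Q1 {:K} c1 ->
  exists c, [/\ has_orth_basis Q {:L}
      ([seq (2 ^ s)%:R * x | x <- c0] ++ [seq (2 ^ s)%:R * x | x <- c1] ++ c),
    ~~ odd (count (fun x => x != 0) c) &
    exists2 e, e != 0 & \prod_(x <- c | x != 0) x = e ^+ 2].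
Proof.
move=> h0 h1; have [gamma [g2 gq]] := exists_sqrt_nonsquare.
have g0 : gamma != 0.
  by apply: contraNneq beta_neq0 => g0; rewrite -(fmorph_eq0 iota) -g2 g0 expr0n.
have [E EE] := exists_eigenspace n 1; have [W WE] := exists_eigenspace n (-1).
have [U1 U1E] := exists_eigenspace (n * 2) 1.
have hE : has_orth_basis Q E [seq (2 ^ s)%:R * x | x <- c0].
  apply: (trace_form_image (gamma := 1) (b := a)) h0; rewrite ?oner_neq0 //.
    by move=> i; rewrite expr1n mulr1.
  move=> x; rewrite EE scale1r; split=> [/eqP/(fixed_in_image p_pr iota)[y ->]|[y ->]].
    by exists y; rewrite mul1r.
  by rewrite mul1r -rmorphXn expr_dim.
have hW : has_orth_basis Q W [seq (2 ^ s)%:R * x | x <- c1].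
  apply: (trace_form_image (gamma := gamma) (b := a')) h1 => //.
    (* As p^alpha_i + 1 is even, this power of gamma is a power of gamma^2 = beta. *)
    move=> i; rewrite rmorphM rmorphXn -g2 -exprM mulnC divnK // dvdn2 oddD oddX p_odd orbT //.
  move=> x; rewrite WE scaleN1r; split=> [/eqP xW|[y ->]].
    (* Both x and gamma change sign under the q-Frobenius, so x / gamma is fixed. *)
    have [|y xy] := @fixed_in_image p K p_pr L iota (x / gamma).
      by rewrite exprMn exprVn xW gq invrN mulrNN.
    by exists y; rewrite -xy mulrC divfK.
  by rewrite exprMn gq -rmorphXn expr_dim // mulNr.
have hU1 : has_orth_basis Q U1
    ([seq (2 ^ s)%:R * x | x <- c0] ++ [seq (2 ^ s)%:R * x | x <- c1]).
  apply: (involution_orth_basis F2 quadQ (sigma := fun x => x ^+ (p ^ n))) hE hW.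
  - by move=> e1 x y; rewrite exprD_pk // exprZ_pk.
  - by move=> x; have := trace_form_frobenius 1 x; rewrite muln1.
  - by move=> x; rewrite U1E scale1r -exprM -expnD addnn muln2.
  - by move=> x; rewrite EE scale1r.
  - by move=> x; rewrite WE scaleN1r.
(* For m = s - 1 the Frobenius exponent is n 2^s, the degree of L, so its fixed space is all of
   L. *)
have [|x|c] := @orth_basis_fixed_space s.-1 _ U1 _ hU1 {:L}.
- by move=> x; rewrite U1E scale1r.
- by rewrite memvf prednK // mulnC -dimL expr_dim // eqxx.
by rewrite -catA => hc; exists c.
Qed.

(** The extra coefficients [c] are even in number and square in product; scaling the others by 2^s
    contributes eta(2)^s for each nonzero one. *)
Lemma rank_type_trace_form :
  [/\ odd (qf_rank Q) = odd (qf_rank Q0 + qf_rank Q1) &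
      qf_type Q = qf_type Q0 * qf_type Q1 *
        (-1) ^+ ((p ^ 2 - 1) %/ 8 * s * (qf_rank Q0 + qf_rank Q1))].
Proof.
have [b0 [bK0 ob0]] := exists_orth_basis F2 quadQ0 {:K}.
have [b1 [bK1 ob1]] := exists_orth_basis F2 quadQ1 {:K}.
have h0 : has_orth_basis Q0 {:K} (map Q0 b0) by exists b0.
have h1 : has_orth_basis Q1 {:K} (map Q1 b1) by exists b1.
move: (map Q0 b0) (map Q1 b1) h0 h1 => c0 c1 h0 h1.
have [c [hc oddc [e e0 ce]]] := orth_basis_trace_form h0 h1.
have [-> ->] := qf_invariants p_pr p_odd quadQ hc.
have [-> ->] := qf_invariants p_pr p_odd quadQ0 h0.
have [-> ->] := qf_invariants p_pr p_odd quadQ1 h1.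
split; first by rewrite !count_cat !count_scale // addnA oddD (negPf oddc) addbF.
rewrite !big_cat /= !prod_scale // ce.
have [i i2] := exists_imaginary_unit.
move: (e ^+ 2) (expf_neq0 2 e0) (quadratic_char_sqr e0) => e2 e20 eta_e.
rewrite !quadratic_charM ?mulf_neq0 ?expf_neq0 ?prod_nz_neq0 // eta_e.
rewrite natrX !quadratic_charX ?expf_neq0 // (quadratic_char2 p_pr p_odd (pchar_ext L p_pr) i2).
by rewrite -!exprM mulnDr exprD mulr1 mulrACA mulrC !mulnA.
Qed.

End ExtensionTraceForm.

(** * Passage from ranks to nullities modulo 2 *)

Theorem theorem5p1 (p n k : nat) (K : splittingFieldType 'F_p)
    (alpha : 'I_k.+1 -> nat) (a : 'I_k.+1 -> K) (beta : K)
    (s : nat) (L : splittingFieldType 'F_p) (iota : {rmorphism K -> L}) :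
  prime p -> odd p -> (1 <= n)%N -> \dim {:K} = n ->
  (forall i j : 'I_k.+1, (i < j)%N -> (alpha i < alpha j)%N) ->
  a ord_max != 0 ->
  (forall y : K, y ^+ 2 != beta) ->
  (0 < s)%N -> \dim {:L} = (2 ^ s * n)%N ->
  let f : {poly K} := \sum_(i < k.+1) a i *: 'X^(p ^ alpha i + 1) in
  let f' : {poly K} :=
    \sum_(i < k.+1)
      (a i * beta ^+ ((p ^ alpha i + 1) %/ 2)) *: 'X^(p ^ alpha i + 1) in
  let l_n : {poly K} -> nat := trace_nullity (idfun : {rmorphism K -> K}) in
  let t_n : {poly K} -> int := trace_type (idfun : {rmorphism K -> K}) in
  let l_2sn : {poly K} -> nat := trace_nullity iota in
  let t_2sn : {poly K} -> int := trace_type iota in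
  [/\ ~~ odd (l_n f + l_n f' + l_2sn f)%N,
      (l_n f = l_n f' %[mod 2] -> t_2sn f = t_n f * t_n f') &
      (l_n f <> l_n f' %[mod 2] ->
        t_2sn f = t_n f * t_n f' * (-1) ^+ ((p ^ 2 - 1) %/ 8 * s))].
Proof.
move=> p_pr p_odd _ dimK _ _ nonsq s_gt0 dimL f f' l_n t_n l_2sn t_2sn.
have dimL' : \dim {:L} = (2 ^ s * \dim {:K})%N by rewrite dimK.
have [odd_rank typeE] := rank_type_trace_form iota alpha a p_pr p_odd s_gt0 dimL' nonsq.
have rank_f := qf_rank_le (trace_form (idfun : {rmorphism K -> K}) f).
have rank_f' := qf_rank_le (trace_form (idfun : {rmorphism K -> K}) f').
have rank_L := qf_rank_le (trace_form iota f).
rewrite -/f -/f' in odd_rank typeE.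
(* Each nullity is [\dim {:K}] minus a rank, and the dimension, occurring twice, drops out modulo
   2. *)
have odd_l : odd (l_n f + l_n f') = odd (qf_rank (trace_form (idfun : {rmorphism K -> K}) f)
    + qf_rank (trace_form (idfun : {rmorphism K -> K}) f')).
  by rewrite /l_n /trace_nullity /qf_nullity oddD (oddB rank_f) (oddB rank_f') addbACA addbb oddD.
have -> : t_2sn f = t_n f * t_n f' * (-1) ^+ ((p ^ 2 - 1) %/ 8 * s * (l_n f + l_n f')).
  by rewrite /t_2sn /trace_type typeE -[in LHS]signr_odd oddM -odd_l -oddM signr_odd.
split=> [|eq_l|neq_l].
(* The dimension of L is even because s > 0, so the nullity over L has the parity of the rank. *)
- rewrite oddD odd_l -odd_rank /l_2sn /trace_nullity /qf_nullity (oddB rank_L) dimL oddM oddX.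
  by rewrite gtn_eqF //= addbb.
- have odd_sum : ~~ odd (l_n f + l_n f') by rewrite -eqn_mod2_odd; apply/eqP.
  by rewrite -[in LHS]signr_odd oddM (negPf odd_sum) andbF mulr1.
- have odd_sum : odd (l_n f + l_n f') by rewrite -[odd _]negbK -eqn_mod2_odd; apply/eqP.
  by rewrite -[in LHS]signr_odd oddM odd_sum andbT signr_odd.
Qed.
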